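(* Let $G$ be a $k$-chromatic graph with an implicit-identity $\{x,y\}$. Then in every proper $k$-coloring of $G$, writing $c$ for the common color of $x$ and $y$, there exist at least $k-1$ Kempe chains with $x$ and $y$ at their extremes, with color pairs $(c,c_i)$ for $k-1$ distinct colors $c_i\neq c$; that is, for each of these $k-1$ colors $c_i$ there is a $(c,c_i)$-Kempe chain containing a path with end-vertices $x$ and $y$.
   Context: All graphs are simple (undirected, no loops, no multiple edges). A $k$-coloring is a proper vertex coloring using a set of $k$ colors. A graph is $k$-chromatic if its chromatic number equals $k$. For a $k$-chromatic graph $G$, a 2-subset $\{i,j\}$ of $V(G)$ with $\{i,j\}\notin E(G)$ is an implicit-identity of $G$ if $i$ and $j$ receive the same color in every $k$-coloring of $G$. Given a proper coloring of $G$, two distinct colors $c_1,c_2$, and a vertex $v$ colored $c_1$ (or $c_2$), the $(c_1,c_2)$-Kempe chain containing $v$ is the maximal connected subset of $V(G)$ containing $v$ all of whose vertices are colored $c_1$ or $c_2$, i.e. the connected component of $v$ in the subgraph induced by the vertices colored $c_1$ or $c_2$. *)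

(* Defs.v *)
From mathcomp Require Import all_boot classical_sets.

Set Implicit Arguments.
Unset Strict Implicit.
Unset Printing Implicit Defensive.

Local Open Scope classical_set_scope.

(* The vertex type is not required to be finite. *)
Record sgraph (V : eqType) := SGraph {
  edge : rel V;
  edge_sym : symmetric edge;
  edge_irr : irreflexive edge
}.

Definition proper_coloring (V : eqType) (G : sgraph V) (k : nat)
    (f : V -> 'I_k) : Prop :=
  forall u v, edge G u v -> f u != f v.

Definition colorable (V : eqType) (G : sgraph V) (k : nat) : Prop :=
  exists f : V -> 'I_k, proper_coloring G f.

Definition chromatic (V : eqType) (G : sgraph V) (k : nat) : Prop :=
  colorable G k /\ forall j, colorable G j -> k <= j.

(* Only meant for [k] the chromatic number of [G]. *)
Definition implicit_identity (V : eqType) (G : sgraph V) (k : nat)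
    (i j : V) : Prop :=
  [/\ i != j, ~~ edge G i j &
      forall f : V -> 'I_k, proper_coloring G f -> f i = f j].

(* [u :: p] is the vertex sequence of a path of [G] from [u] to [v] without
   repeated vertices, all of whose vertices lie in [A]. *)
Definition path_in (V : eqType) (G : sgraph V) (A : set V) (u v : V)
    (p : seq V) : Prop :=
  [/\ path (edge G) u p, last u p = v, uniq (u :: p) &
      forall w, w \in u :: p -> A w].

Definition connected_in (V : eqType) (G : sgraph V) (A : set V) : Prop :=
  forall u v, A u -> A v -> exists p, path_in G A u v p.

Definition two_colored (V : eqType) (k : nat) (f : V -> 'I_k)
    (c1 c2 : 'I_k) : set V :=
  [set v | f v = c1 \/ f v = c2].

Definition kempe_chain (V : eqType) (G : sgraph V) (k : nat) (f : V -> 'I_k)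
    (c1 c2 : 'I_k) (v : V) (K : set V) : Prop :=
  [/\ c1 != c2, K v, K `<=` two_colored f c1 c2, connected_in G K &
      forall L : set V, K `<=` L -> L `<=` two_colored f c1 c2 ->
        connected_in G L -> L = K].

(* Main.v *)
(** If [y] were outside the [(c, ci)]-Kempe chain of [x], exchanging [c] and
    [ci] on that chain would give a proper [k]-coloring separating [x] from
    [y]. So every chain of [x] with a color [ci != c] reaches [y]. The
    chains for different [ci] are distinct because the second vertex of a path
    from [x] to [y] has color [ci]. *)
Require Import Defs.
From mathcomp Require Import all_boot classical_sets.
From mathcomp Require Import perm boolp.

Set Implicit Arguments.
Unset Strict Implicit.
Unset Printing Implicit Defensive.

Local Open Scope classical_set_scope.

Section Component.
Variables (V : eqType) (G : sgraph V).
Implicit Types (A : set V) (u v w : V) (p : seq V).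

(** Empty when [u] lies outside [A], since [path_in] constrains the starting vertex too. *)
Definition component A u : set V := [set v | exists p, path_in G A u v p].

(** Walks can thus be reversed, concatenated or extended freely, with repetitions removed only at
    the end. *)
Lemma path_in_shorten A u v p :
  path (edge G) u p -> last u p = v -> (forall w, w \in u :: p -> A w) ->
  exists q, path_in G A u v q.
Proof.
move=> up + Ap; case: (shortenP up) => q uq q_uniq qp <-.
exists q; split=> // w; rewrite inE => /predU1P[->|/qp pw].
  by apply: Ap; rewrite mem_head.
by apply: Ap; rewrite inE pw orbT.
Qed.

Lemma component_refl A u : A u -> component A u u.
Proof. by move=> Au; exists [::]; split=> // w; rewrite inE => /eqP->. Qed.

Lemma component_sub A u : component A u `<=` A.
Proof. by move=> v [p [_ <- _]]; apply; apply: mem_last. Qed.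

Lemma component_sym A u v : component A u v -> component A v u.
Proof.
(* The reversed vertex sequence starts at [v], so the tail to supply is [rev (belast u p)]. *)
case=> p [up <- _ Ap]; apply: (@path_in_shorten _ _ _ (rev (belast u p))).
- by rewrite rev_path (eq_path (e' := edge G)) // => a b; rewrite edge_sym.
- by case: p {up Ap} => //= a p; rewrite rev_cons last_rcons.
- move=> w; rewrite -rev_rcons -lastI mem_rev; exact: Ap.
Qed.

Lemma component_trans A u v w :
  component A u v -> component A v w -> component A u w.
Proof.
move=> [p [up uv _ Ap]] [q [vq vw _ Aq]].
apply: (@path_in_shorten _ _ _ (p ++ q)).
- by rewrite cat_path up uv.
- by rewrite last_cat uv.
- move=> a; rewrite -cat_cons mem_cat => /orP[/Ap //|aq].
  by apply: Aq; rewrite inE aq orbT.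
Qed.

Lemma component_edge A u v w :
  component A u v -> A w -> edge G v w -> component A u w.
Proof.
move=> uv Aw vw; apply: (component_trans uv).
apply: (@path_in_shorten _ _ _ [:: w]) => //=; first by rewrite vw.
by move=> a; rewrite !inE => /orP[] /eqP-> //; apply: component_sub uv.
Qed.

(** The prefix of the path that ends at a given vertex connects [u] to this vertex inside [A]. *)
Lemma path_in_component A u v p :
  path_in G A u v p -> path_in G (component A u) u v p.
Proof.
move=> [up uv p_uniq Ap]; split=> // w wp.
have [wu|wp'] := predU1P wp.
  by rewrite wu; apply/component_refl/Ap/mem_head.
move: up Ap; case: (splitPr wp') => p1 p2; rewrite -cat_rcons cat_path.
move=> /andP[up1 _] Ap; apply: (path_in_shorten up1 (last_rcons _ _ _)) => a ap1.
by apply: Ap; rewrite -cat_cons mem_cat ap1.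
Qed.

(** Going from [v] to [w] through [u] gives a path in [A]. It stays in the component of [v], hence
    in that of [u] by transitivity. *)
Lemma component_connected A u : connected_in G (component A u).
Proof.
move=> v w uv uw.
have [p /path_in_component[vp lvp p_uniq pK]] :=
  component_trans (component_sym uv) uw.
by exists p; split=> // a /pK; apply: component_trans.
Qed.

Lemma component_max A u (L : set V) :
  L u -> L `<=` A -> connected_in G L -> L `<=` component A u.
Proof.
move=> Lu LA Lconn v Lv; have [p [up uv p_uniq pL]] := Lconn u v Lu Lv.
by exists p; split=> // w /pL/LA.
Qed.

End Component.

Section Kempe.
Variables (V : eqType) (G : sgraph V) (k : nat) (f : V -> 'I_k).
Hypothesis f_proper : proper_coloring G f.
Variables (c d : 'I_k) (x : V).

Let K := component G (two_colored f c d) x.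

Lemma kempe_chain_component :
  c != d -> two_colored f c d x -> kempe_chain G f c d x K.
Proof.
move=> cd xA; have Kx : K x by apply: component_refl.
split=> //; first exact: component_sub; first exact: component_connected.
move=> L KL LA Lconn; apply/seteqP; split=> //.
by apply: component_max => //; apply: KL.
Qed.

(** Membership in [K] is decided classically, because [V] may be infinite. *)
Definition kempe_swap (v : V) : 'I_k :=
  if `[< K v >] then tperm c d (f v) else f v.

(** Inside [K] the colors are permuted injectively. On an edge leaving [K], the inner end keeps a
    color among [c] and [d], while the outer end has neither, as it would otherwise belong to
    [K]. *)
Lemma kempe_swap_proper : proper_coloring G kempe_swap.
Proof.
have boundary u v : edge G u v -> K u -> ~ K v -> tperm c d (f u) != f v.
  move=> uv Ku nKv; apply/eqP => fuv; apply: nKv.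
  apply: (component_edge Ku _ uv); rewrite /two_colored /= -fuv.
  by case: (component_sub Ku) => ->; rewrite ?tpermL ?tpermR; [right|left].
move=> u v uv; rewrite /kempe_swap.
case: asboolP => Ku; case: asboolP => Kv.
- by rewrite (inj_eq perm_inj); apply: f_proper.
- exact: boundary.
- by rewrite eq_sym; apply: boundary; rewrite // edge_sym.
- exact: f_proper.
Qed.

End Kempe.

Lemma implicit_identity_kempe (V : eqType) (G : sgraph V) (k : nat) (x y : V)
    (f : V -> 'I_k) (d : 'I_k) :
  implicit_identity G k x y -> proper_coloring G f -> f x != d ->
  component G (two_colored f (f x) d) x y.
Proof.
move=> [_ _ same] f_proper xd; apply: contrapT => nKy.
(* The swap gives [x] the color [d] and leaves [y] with the color [f y], which equals [f x]. *)
have /same := kempe_swap_proper f_proper (f x) d x.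
rewrite /kempe_swap (asboolF nKy) asboolT ?tpermL; last first.
  by apply: component_refl; left.
by rewrite -(same f f_proper) => dx; rewrite dx eqxx in xd.
Qed.

Lemma component_has_second_color (V : eqType) (G : sgraph V) (k : nat)
    (f : V -> 'I_k) (d : 'I_k) (x y : V) :
  proper_coloring G f -> x != y -> component G (two_colored f (f x) d) x y ->
  exists2 v, component G (two_colored f (f x) d) x v & f v = d.
Proof.
(* The empty path would force [x = y]; otherwise the witness is the neighbor of [x] on the path. *)
move=> f_proper xy [[|v p] /path_in_component[/= xp lxy _ pK]].
  by rewrite lxy eqxx in xy.
have Kv : component G (two_colored f (f x) d) x v.
  by apply: pK; rewrite !inE eqxx orbT.
exists v => //; have [xv _] := andP xp.
by case: (component_sub Kv) => // fvx; have := f_proper _ _ xv; rewrite fvx eqxx.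
Qed.

Theorem theorem3p15 (V : eqType) (G : sgraph V) (k : nat) (x y : V)
    (hG : chromatic G k) (hxy : implicit_identity G k x y)
    (f : V -> 'I_k) (hf : proper_coloring G f)
    (c : 'I_k) (hx : f x = c) (hy : f y = c) :
  exists (col : 'I_(k - 1) -> 'I_k) (K : 'I_(k - 1) -> set V),
    [/\ injective col, injective K &
        forall i : 'I_(k - 1),
          [/\ col i != c, kempe_chain G f c (col i) x (K i) &
              exists p : seq V, path_in G (K i) x y p]].
Proof.
have [xy _ _] := hxy; subst c.
(* [lift (f x)] enumerates the colors while skipping [f x]; the cast only identifies [k - 1] with
   [k.-1]. *)
pose col (i : 'I_(k - 1)) := lift (f x) (cast_ord (subn1 k) i).
have col_inj : injective col by move=> i j /lift_inj/cast_ord_inj.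
have xcol i : f x != col i by apply: neq_lift.
have Ky i := implicit_identity_kempe hxy hf (xcol i).
exists col, (fun i => component G (two_colored f (f x) (col i)) x); split=> //.
- move=> i j Kij; apply: col_inj.
  (* A vertex of color [col i] in the common chain has color [f x] or [col j], and the former is
     excluded. *)
  have [v + vi] := component_has_second_color hf xy (Ky i).
  rewrite Kij => /component_sub[vx|<- //].
  by have := xcol i; rewrite -vi vx eqxx.
- move=> i; split; first by rewrite eq_sym.
    by apply: kempe_chain_component => //; left.
  by have [p /path_in_component] := Ky i; exists p.
Qed.
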